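(* Let $\alpha_1,\alpha_2,a_1,a_2\in\mathbb{R}$. For every integer $N\ge 0$ and all $x\in\mathbb{R}$, $$Q_{N}^{(\alpha_1+\alpha_2,\,-a_1-a_2-1)}(x)=\sum_{\nu_1=0}^N\binom{N}{\nu_1}Q_{\nu_1}^{(\alpha_1,-a_1)}(x)\,Q_{N-\nu_1}^{(\alpha_2,-a_2)}(x).$$
   Context: Throughout $x$ is a real variable, $\alpha,a$ are real parameters, $\sigma(x)=1+x^2$, and $\cot^{-1}:\mathbb{R}\to(0,\pi)$ is the smooth branch, so that $\frac{d}{dx}\cot^{-1}x=-1/\sigma(x)$. For integers $l\ge 0$ put $w_l(x)=\sigma(x)^{-(l+a+1)}e^{-\alpha\cot^{-1}x}=\sigma(x)^{-l}w_0(x)$. Define $P_l^{(a,\alpha)}(x)=\frac{1}{w_l(x)}\frac{d^l}{dx^l}[w_l(x)\sigma(x)^l]=\frac{\sigma(x)^l}{w_0(x)}\frac{d^l w_0(x)}{dx^l}$. The complementary (Romanovski) polynomials $Q_\nu^{(\alpha,-a)}$, with $Q_0^{(\alpha,-a)}\equiv 1$, are defined by the Rodrigues representation $P_l^{(a,\alpha)}(x)=\frac{1}{w_l(x)}\frac{d^{l-\nu}}{dx^{l-\nu}}[\sigma(x)^{l-\nu}w_l(x)Q_\nu^{(\alpha,-a)}(x)]$ for all integers $0\le\nu\le l$ (the case $l=\nu$ reads $Q_\nu^{(\alpha,-a)}=P_\nu^{(a,\alpha)}$). The second upper index is minus the parameter $a$ of the weight. *)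

(* Defs.v *)
From HB Require Import structures.
From mathcomp Require Import all_boot all_order all_algebra.
From mathcomp Require Import all_classical all_reals all_analysis.
From mathcomp Require Import ring.

Set Implicit Arguments.
Unset Strict Implicit.
Unset Printing Implicit Defensive.

Import Order.TTheory GRing.Theory Num.Theory.
Import numFieldNormedType.Exports.

Local Open Scope classical_set_scope.
Local Open Scope ring_scope.

(* acot_itv and acotK characterise this as the branch R -> ]0, pi[. *)
Definition acot (R : realType) (x : R) : R := pi / 2 - atan x.

Definition sigma (R : realType) (x : R) : R := 1 + x ^+ 2.

Definition weight (R : realType) (a alpha : R) (l : nat) (x : R) : R :=
  sigma x `^ (- (l%:R + a + 1)) * expR (- (alpha * acot x)).

Definition rodriguesP (R : realType) (a alpha : R) (l : nat) (x : R) : R :=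
  (weight a alpha l x)^-1 *
  derive1n l (fun y : R => weight a alpha l y * sigma y ^+ l) x.

(* The Rodrigues representation of the family Q_nu^(alpha, b), where the second
   upper index b is minus the parameter a of the weight, hence - b below. *)
Definition complementary (R : realType) (alpha b : R) (Q : nat -> {poly R}) :
    Prop :=
  Q 0%N = 1 /\
  forall nu l : nat, (nu <= l)%N -> forall x : R,
    rodriguesP (- b) alpha l x =
    (weight (- b) alpha l x)^-1 *
    derive1n (l - nu) (fun y : R =>
      sigma y ^+ (l - nu) * weight (- b) alpha l y * (Q nu).[y]) x.

Lemma acot_itv (R : realType) (x : R) : 0 < acot x < pi.
Proof.
rewrite /acot subr_gt0 atan_ltpi2/= ltrBlDr -ltrBlDl.
by rewrite [X in _ - X]splitr opprD addrA subrr sub0r atan_gtNpi2.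
Qed.

Lemma acotK (R : realType) (x : R) : cos (acot x) / sin (acot x) = x.
Proof.
rewrite /acot cosB sinB cos_pihalf sin_pihalf.
by rewrite !mul0r !mul1r add0r subr0 -[RHS]atanK.
Qed.

Lemma is_derive_acot (R : realType) (x : R) :
  is_derive x 1 (@acot R) (- (sigma x)^-1).
Proof.
have -> : @acot R = cst (pi / 2) - atan by [].
apply: is_derive_eq; rewrite ?sub0r//.
Qed.

Lemma sigma_gt0 (R : realType) (x : R) : 0 < sigma x.
Proof. by rewrite ltr_wpDr// sqr_ge0. Qed.

Lemma weight_gt0 (R : realType) (a alpha : R) (l : nat) (x : R) : 0 < weight a alpha l x.
Proof. by rewrite mulr_gt0 ?expR_gt0// powR_gt0// sigma_gt0. Qed.

Lemma weightD (R : realType) (a alpha : R) (k l : nat) (x : R) :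
  sigma x ^+ k * weight a alpha (k + l) x = weight a alpha l x.
Proof.
rewrite /weight mulrA -powR_mulrn ?ltW ?sigma_gt0// -powRD; last first.
  by apply/implyP => _; rewrite gt_eqF// sigma_gt0.
by congr (_ `^ _ * _); rewrite natrD; ring.
Qed.

Lemma is_derive_weight_horner (R : realType) (a alpha : R) (n : nat)
    (p : {poly R}) (x : R) :
  is_derive x 1 (fun y : R => weight a alpha n y * p.[y])
    (weight a alpha n.+1 x *
     ((1 + 'X^2) * p^`() + (alpha%:P - (2 * (n%:R + a + 1)) *: 'X) * p).[x]).
Proof.
have s0 := sigma_gt0 x.
set e := - (n%:R + a + 1).
have ds : is_derive x 1 (@sigma R) (2 * x).
  have -> : @sigma R = cst 1 + (fun y => y ^+ 2) by [].
  apply: is_derive_eq; rewrite /GRing.scale /=; ring.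
have dp : is_derive x 1 (fun y : R => sigma y `^ e)
    ((e * sigma x `^ (e - 1)) * (2 * x)).
  have dpow := is_derive1_powR e s0.
  exact: (@is_derive1_comp _ (fun y : R => y `^ e) (@sigma R) _ _ _ dpow ds).
have da : is_derive x 1 (fun y : R => - (alpha * acot y))
    (- (alpha * - (sigma x)^-1)) := is_deriveN (is_deriveZ alpha (is_derive_acot x)).
have de : is_derive x 1 (fun y : R => expR (- (alpha * acot y)))
    (expR (- (alpha * acot x)) * (- (alpha * - (sigma x)^-1))).
  exact: (@is_derive1_comp _ (@expR R) (fun y : R => - (alpha * acot y))
    _ _ _ (is_derive_expR _) da).
have dw : is_derive x 1 (weight a alpha n) _ := is_deriveM dp de.
have -> : (fun y : R => weight a alpha n y * p.[y]) =
  (weight a alpha n \* horner p) by [].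
apply: is_derive_eq.
rewrite !hornerE /= -(weightD a alpha 1 n) add1n expr1.
have -> : sigma x `^ e = sigma x * sigma x `^ (- (n.+1%:R + a + 1)).
  rewrite -[X in X * _]powRr1 ?ltW// -powRD; last first.
    by apply/implyP => _; rewrite gt_eqF.
  by congr (_ `^ _); rewrite /e -natr1; ring.
have -> : e - 1 = - (n.+1%:R + a + 1) by rewrite /e -natr1; ring.
rewrite /weight /GRing.scale /= /e.
have -> : 1 + x ^+ 2 = sigma x by [].
by field; rewrite gt_eqF.
Qed.

Lemma derive1n_weight (R : realType) (a alpha : R) :
  exists2 q : nat -> {poly R}, q 0%N = 1 &
  forall n, derive1n n (weight a alpha 0) = (fun x => weight a alpha n x * (q n).[x]).
Proof.
exists (fix q n := if n is m.+1 then (1 + 'X^2) * (q m)^`() +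
  (alpha%:P - (2 * (m%:R + a + 1)) *: 'X) * q m else 1) => //.
elim=> [|n IH]; first by apply/funext => x; rewrite hornerC mulr1.
rewrite derive1nS IH; apply/funext => x.
by rewrite derive1E (@derive_val _ _ _ _ _ _ _
  (is_derive_weight_horner a alpha n _ x)).
Qed.

Lemma rodriguesPE (R : realType) (a alpha : R) (l : nat) (x : R) :
  rodriguesP a alpha l x =
  sigma x ^+ l / weight a alpha 0 x * derive1n l (weight a alpha 0) x.
Proof.
rewrite /rodriguesP; congr (_ * _).
  rewrite -(weightD a alpha l 0) addn0; field.
  by rewrite expf_neq0 !gt_eqF ?sigma_gt0 ?weight_gt0.
congr (derive1n l _ x); apply/funext => y.
by rewrite mulrC -(weightD _ _ l 0) addn0.
Qed.

Lemma complementary_exists (R : realType) (alpha b : R) :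
  exists Q, complementary alpha b Q.
Proof.
have [q q0 qE] := derive1n_weight (- b) alpha.
exists q; split=> // nu l nul x; congr (_ * _).
have -> : (fun y => sigma y ^+ (l - nu) * weight (- b) alpha l y * (q nu).[y])
    = derive1n nu (weight (- b) alpha 0).
  by rewrite qE; apply/funext => y; rewrite -{2}(subnK nul) weightD.
rewrite /derive1n -iterD subnK//; congr (iter l _ _ x).
by apply/funext => y; rewrite mulrC -(weightD _ _ l 0) addn0.
Qed.

Lemma complementary_unique (R : realType) (alpha b : R) Q1 Q2 :
  complementary alpha b Q1 -> complementary alpha b Q2 -> Q1 = Q2.
Proof.
have E Q : complementary alpha b Q -> forall nu x,
    rodriguesP (- b) alpha nu x = (Q nu).[x].
  move=> [_ H] nu x; rewrite (H nu nu)// subnn /derive1n/= expr0 mul1r mulKf//.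
  by rewrite gt_eqF// weight_gt0.
move=> /E E1 /E E2; apply/funext => nu.
apply/eqP; rewrite -subr_eq0; apply/negPn/negP => nz.
pose s : seq R := [seq k%:R | k <- iota 0 (size (Q1 nu - Q2 nu))].
have : (size s < size (Q1 nu - Q2 nu)%R)%N.
  apply: max_poly_roots => //; last first.
    by rewrite map_inj_uniq ?iota_uniq//; exact: mulrIn (oner_neq0 R).
  by apply/allP => y _; rewrite /root !hornerE -E1 -E2 subrr.
by rewrite size_map size_iota ltnn.
Qed.

(* Q_nu^(alpha, b); by complementary_unique the choice is forced. *)
Definition Qpoly (R : realType) (alpha b : R) : nat -> {poly R} :=
  projT1 (cid (complementary_exists alpha b)).

Lemma QpolyP (R : realType) (alpha b : R) :
  complementary alpha b (Qpoly alpha b).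
Proof. exact: projT2 (cid (complementary_exists alpha b)). Qed.

(* Main.v *)
Require Import Defs.
From mathcomp Require Import all_boot all_order all_algebra.
From mathcomp Require Import all_classical all_reals all_analysis.
From mathcomp Require Import ring.
Import Order.TTheory GRing.Theory Num.Theory.
Local Open Scope ring_scope.

(** Write [w_n^(a,alpha)] for [weight a alpha n].  The Rodrigues formula at
    [l = nu] says that [Q_n^(alpha,-a)] is exactly what is left when the base
    weight is differentiated [n] times:
      [(w_0^(a,alpha))^(n) = w_n^(a,alpha) * Q_n^(alpha,-a)]
    (lemma [derive1n_weight_Qpoly]).  On the other hand the weights multiply
    like exponentials: both parameters and the index add, up to a shift of
    [a1 + a2] by 1 which comes from the 1 in the exponent [-(l + a + 1)] being
    counted twice (lemma [weightM]).  So the product of the two base weights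
    is again a base weight, with parameters [a1 + a2 + 1], [alpha1 + alpha2],
    and the theorem is the Leibniz rule for the [N]-th derivative of that
    product (lemma [derive1nM]): the term of index [i] carries the factor
    [w_i^(a1,alpha1) * w_(N-i)^(a2,alpha2)], which by the same multiplication
    law is [w_N^(a1+a2+1,alpha1+alpha2)] whatever [i] is, and this common
    positive factor cancels. *)

(** Pascal's rule in the form used to differentiate a binomial sum: [F i] and
    [G j] stand for the [i]-th and [j]-th derivatives of two factors. *)
Lemma sum_binS {V : pzRingType} (F G : nat -> V) (n : nat) :
  \sum_(i < n.+1) (F i * G (n - i).+1 + F i.+1 * G (n - i)%N) *+ 'C(n, i) =
  \sum_(i < n.+2) (F i * G (n.+1 - i)%N) *+ 'C(n.+1, i).
Proof.
under eq_bigr => i _ do rewrite mulrnDl.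
rewrite big_split /= [RHS]big_ord_recl bin0 subn0.
under [in RHS]eq_bigr => i _ do rewrite /= /bump add1n binS mulrnDr subSS.
rewrite big_split /= addrA; congr (_ + _).
rewrite big_ord_recl bin0 subn0; congr (_ + _).
(* the extra last term on the right has coefficient 'C(n, n.+1) = 0 *)
rewrite [RHS]big_ord_recr /= bin_small// mulr0n addr0.
by apply: eq_bigr => i _; rewrite /bump add1n subnSK.
Qed.

(** The Leibniz rule, by induction on [n]: differentiating the binomial sum
    term by term gives the left-hand side of [sum_binS]. *)
Lemma derive1nM {R : realType} (f g : R -> R) (n : nat) :
  (forall k x, (k < n)%N -> derivable (derive1n k f) x 1) ->
  (forall k x, (k < n)%N -> derivable (derive1n k g) x 1) ->
  forall x, derive1n n (fun y => f y * g y) x =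
    \sum_(i < n.+1) (derive1n i f x * derive1n (n - i) g x) *+ 'C(n, i).
Proof.
elim: n => [|n IH] df dg x; first by rewrite big_ord1.
(* an equality of functions in the shape that [is_derive_sum] expects *)
have {}IH : derive1n n (fun y => f y * g y) = \sum_(i < n.+1)
    'C(n, i)%:R \*: (derive1n i f * derive1n (n - i) g).
  apply/funext => y; rewrite fct_sumE IH => [|k z kn|k z kn].
  - by apply: eq_bigr => i _; rewrite -mulr_natl.
  - exact: df (ltnW kn).
  - exact: dg (ltnW kn).
have D (h : R -> R) : derivable h x 1 -> is_derive x 1 h (derive1 h x).
  by move=> dh; rewrite derive1E; exact: derivableP.
rewrite derive1nS IH derive1E.
rewrite -(sum_binS (fun i => derive1n i f x) (fun i => derive1n i g x)).
rewrite (@derive_val _ _ _ _ _ _ _ (is_derive_sum (fun i : 'I_n.+1 =>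
  is_deriveZ _ (is_deriveM (D _ (df i x (ltn_ord i)))
    (D _ (dg (n - i)%N x (leq_subr i n))))))).
apply: eq_bigr => i _; rewrite !derive1nS scaler_nat /GRing.scale /=.
by rewrite [X in _ + X]mulrC.
Qed.

Lemma derivable_derive1n_weight {R : realType} (a alpha : R) (n : nat) (x : R) :
  derivable (derive1n n (weight a alpha 0)) x 1.
Proof.
have [q _ ->] := derive1n_weight a alpha.
by have [] := is_derive_weight_horner a alpha n (q n) x.
Qed.

(** The Rodrigues representation with [l = n], where its outer derivative
    disappears. *)
Lemma derive1n_weight_Qpoly {R : realType} (a alpha : R) (n : nat) (x : R) :
  derive1n n (weight a alpha 0) x = weight a alpha n x * (Qpoly alpha (- a) n).[x].
Proof.
have [_ /(_ n n (leqnn n) x)] := QpolyP alpha (- a).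
rewrite opprK subnn derive1n0 expr0 mul1r mulKf ?gt_eqF ?weight_gt0// => <-.
rewrite rodriguesPE -(weightD a alpha n 0) addn0; field.
by rewrite expf_neq0 !gt_eqF ?sigma_gt0 ?weight_gt0.
Qed.

Lemma weightM {R : realType} (a1 alpha1 a2 alpha2 : R) (k l : nat) (x : R) :
  weight a1 alpha1 k x * weight a2 alpha2 l x =
  weight (a1 + a2 + 1) (alpha1 + alpha2) (k + l) x.
Proof.
rewrite /weight mulrACA -powRD; last first.
  by apply/implyP => _; rewrite gt_eqF// sigma_gt0.
by rewrite -expRD natrD; congr (_ `^ _ * expR _); ring.
Qed.

Theorem theorem2p1 (R : realType) (alpha1 alpha2 a1 a2 : R) (N : nat) (x : R) :
  (Qpoly (alpha1 + alpha2) (- a1 - a2 - 1) N).[x] =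
  \sum_(0 <= nu1 < N.+1)
    'C(N, nu1)%:R * (Qpoly alpha1 (- a1) nu1).[x]
                  * (Qpoly alpha2 (- a2) (N - nu1)).[x].
Proof.
have -> : - a1 - a2 - 1 = - (a1 + a2 + 1) by ring.
have w0 : weight (a1 + a2 + 1) (alpha1 + alpha2) N x != 0.
  by rewrite gt_eqF// weight_gt0.
apply: (mulfI w0); rewrite -derive1n_weight_Qpoly.
have -> : weight (a1 + a2 + 1) (alpha1 + alpha2) 0 =
    fun y => weight a1 alpha1 0 y * weight a2 alpha2 0 y.
  by apply/funext => y; rewrite weightM.
rewrite derive1nM; try by move=> k y _; exact: derivable_derive1n_weight.
rewrite big_mkord mulr_sumr; apply: eq_bigr => i _.
have iN : (i <= N)%N by rewrite -ltnS.
rewrite !derive1n_weight_Qpoly mulrACA weightM subnKC// -mulr_natl.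
ring.
Qed.
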